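(* Let $G_{S,1}$ and $G_{S,2}$ be two self-loop graphs of the same order $N$ (each with at least one loop), and let $\widetilde G_1$, $\widetilde G_2$ be their Açıkmeşe lifts, with the same vertex ordering $1,\dots,N,N+1,\dots,2N+1$. Let $T$ be the common involution matrix, which swaps the two copies and fixes the middle vertex. Then for every $h\in\mathbb{Z}_2$ and every $t>0$, $$\big|\chi_t^{\widetilde G_1}(h)-\chi_t^{\widetilde G_2}(h)\big|\le t\,\|\mathcal{L}(\widetilde G_1)-\mathcal{L}(\widetilde G_2)\|_1,$$ where $\|\cdot\|_1$ denotes the trace norm (sum of singular values).
   Context: A self-loop graph $G_S$ of order $N$ is obtained from a finite undirected simple graph $G$ with vertex set $\{1,\dots,N\}$ (possibly disconnected) by attaching one loop at every vertex of a subset $S$; the two self-loop graphs may have different underlying graphs and different loop sets. For $|S|\ge1$, the Açıkmeşe lift $\widetilde G=(\widetilde V,\widetilde E)$ of $G_S$ is the simple graph on $\widetilde V=\{1,\dots,2N+1\}$ such that: for each edge $\{i,j\}$ of $G$, both $\{i,j\}$ and $\{i+N+1,j+N+1\}$ are edges of $\widetilde G$; for each $i\in S$, both $\{i,N+1\}$ and $\{N+1,i+N+1\}$ are edges; there are no other edges. $\mathcal{L}(\widetilde G)=D(\widetilde G)-A(\widetilde G)$ is the ordinary Laplacian of $\widetilde G$. The involution matrix $T$ is the $(2N+1)\times(2N+1)$ permutation matrix of the map swapping $i\leftrightarrow i+N+1$ ($1\le i\le N$) and fixing $N+1$. Let $\rho$ be the representation of $\mathbb{Z}_2=\{1,g\}$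 on $\mathbb{R}^{2N+1}$ with $\rho(1)=I$, $\rho(g)=T$. The equivariant heat character is $\chi_t^{\widetilde G}(h)=\mathrm{Tr}(e^{-t\mathcal{L}(\widetilde G)}\rho(h))$ for $h\in\mathbb{Z}_2$, $t>0$. *)

(* Defs.v *)
From HB Require Import structures.
From mathcomp Require Import all_boot all_order all_algebra all_fingroup.
From mathcomp Require Import mxrepresentation.
From mathcomp Require polyrcf.
From mathcomp Require Import all_classical all_reals all_analysis.
Import Order.TTheory GRing.Theory Num.Theory.
Import numFieldNormedType.Exports.

Set Implicit Arguments.
Unset Strict Implicit.
Unset Printing Implicit Defensive.

Local Open Scope ring_scope.

Record simple_graph (n : nat) := SimpleGraph {
  adj : rel 'I_n;
  adj_sym : symmetric adj;
  adj_irrefl : irreflexive adj }.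

Record self_loop_graph (N : nat) := SelfLoopGraph {
  underlying : simple_graph N;
  loops : {set 'I_N} }.

Definition degree n (G : simple_graph n) (i : 'I_n) : nat :=
  #|[set j | adj G i j]|.

Definition adjacency_mx (R : realType) n (G : simple_graph n) : 'M[R]_n :=
  \matrix_(i, j) (adj G i j)%:R.

Definition laplacian_mx (R : realType) n (G : simple_graph n) : 'M[R]_n :=
  diag_mx (\row_i (degree G i)%:R) - adjacency_mx R G.

(* Ordinals start at 0, so the vertices i, N + 1 and i + N + 1 of the 1-based
   numbering have values i, N and i + N.+1 here, with i < N. *)
Definition left_copy N (i : 'I_N) : 'I_(2 * N).+1 := inord i.
Definition middle N : 'I_(2 * N).+1 := inord N.
Definition right_copy N (i : 'I_N) : 'I_(2 * N).+1 := inord (i + N.+1).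

Lemma val_left_copy N (i : 'I_N) : left_copy i = i :> nat.
Proof.
by rewrite inordK // ltnS (leq_trans (ltnW (ltn_ord i))) // mul2n -addnn leq_addr.
Qed.

Lemma val_middle N : middle N = N :> nat.
Proof. by rewrite inordK // ltnS mul2n -addnn leq_addr. Qed.

Lemma val_right_copy N (i : 'I_N) : right_copy i = (i + N.+1)%N :> nat.
Proof. by rewrite inordK // ltnS addnS -addSn mul2n -addnn leq_add2r. Qed.

Definition lift_edge N (GS : self_loop_graph N) : rel 'I_(2 * N).+1 :=
  fun u v =>
    [exists i, exists j, adj (underlying GS) i j &&
      (((u == left_copy i) && (v == left_copy j))
       || ((u == right_copy i) && (v == right_copy j)))]
    || [exists i in loops GS,
         [|| (u == left_copy i) && (v == middle N),
             (u == middle N) && (v == left_copy i),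
             (u == middle N) && (v == right_copy i) |
             (u == right_copy i) && (v == middle N)]].

Lemma lift_edge_sym N (GS : self_loop_graph N) : symmetric (lift_edge GS).
Proof.
suff H u v : lift_edge GS u v -> lift_edge GS v u.
  by move=> u v; apply/idP/idP; apply: H.
case/orP => [/existsP[i /existsP[j /andP[ij H]]]|/existsP[i /andP[iS H]]].
  apply/orP; left; apply/existsP; exists j; apply/existsP; exists i.
  by rewrite adj_sym ij /= [X in X || _]andbC [X in _ || X]andbC.
apply/orP; right; apply/existsP; exists i; rewrite iS /=.
by case/or4P: H => /andP[-> ->]; rewrite ?orbT.
Qed.

Lemma lift_edge_irrefl N (GS : self_loop_graph N) : irreflexive (lift_edge GS).
Proof.
move=> u; apply/negbTE/negP.
case/orP => [/existsP[i /existsP[j /andP[ij H]]]|/existsP[i /andP[_ H]]].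
  suff eq_ij : i = j by rewrite eq_ij adj_irrefl in ij.
  apply/val_inj; case/orP: H => /andP[/eqP -> /eqP /(congr1 val)] /=.
    by rewrite !val_left_copy.
  by rewrite !val_right_copy => /addIn.
have ltiN := ltn_ord i.
have E1 : left_copy i != middle N.
  by rewrite -val_eqE /= val_left_copy val_middle neq_ltn ltiN.
have E2 : right_copy i != middle N.
  by rewrite -val_eqE /= val_right_copy val_middle neq_ltn addnS ltnS leq_addl orbT.
by case/or4P: H => /andP[/eqP -> /eqP E]; move: E1 E2; rewrite -?E ?E eqxx.
Qed.

Definition acikmese_lift N (GS : self_loop_graph N) : simple_graph (2 * N).+1 :=
  SimpleGraph (@lift_edge_sym N GS) (@lift_edge_irrefl N GS).

Definition swap_copies N (u : 'I_(2 * N).+1) : 'I_(2 * N).+1 :=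
  if (u < N)%N then inord (u + N.+1)
  else if u == N :> nat then u
  else inord (u - N.+1).

Lemma swap_copiesK N : involutive (@swap_copies N).
Proof.
move=> u; have ltu : (u < N + N.+1)%N.
  have e : (N + N.+1)%N = (2 * N).+1 by rewrite addnS addnn mul2n.
  by rewrite e ltn_ord.
apply: val_inj; rewrite {2}/swap_copies /=.
have [ltuN|gtuN|eqN] := ltngtP (nat_of_ord u) N.
- have lt2 : (u + N.+1 < (2 * N).+1)%N.
    have e : (2 * N).+1 = (N + N.+1)%N by rewrite addnS addnn mul2n.
    by rewrite [ltnRHS]e ltn_add2r.
  have lt3 : (N < u + N.+1)%N by rewrite leq_addl.
  by rewrite /swap_copies inordK // ltnNge (ltnW lt3) /= gtn_eqF // addnK inordK.
- have leN : (u - N.+1 <= u)%N by rewrite leq_subr.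
  have lt1 : (u - N.+1 < (2 * N).+1)%N by exact: leq_ltn_trans leN (ltn_ord u).
  have lt2 : (u - N.+1 < N)%N by rewrite ltn_subLR // addnC.
  by rewrite /swap_copies inordK // lt2 subnK // inordK.
- by rewrite /swap_copies eqN ltnn eqxx.
Qed.

Definition swap_perm N : {perm 'I_(2 * N).+1} :=
  perm (inv_inj (@swap_copiesK N)).

Lemma swap_perm_left N (i : 'I_N) : swap_perm N (left_copy i) = right_copy i.
Proof. by rewrite permE /swap_copies val_left_copy ltn_ord. Qed.

Lemma swap_perm_middle N : swap_perm N (middle N) = middle N.
Proof. by rewrite permE /swap_copies val_middle ltnn eqxx. Qed.

Lemma swap_perm_right N (i : 'I_N) : swap_perm N (right_copy i) = left_copy i.
Proof. by rewrite -swap_perm_left !permE swap_copiesK. Qed.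

Definition involution_mx (R : realType) N : 'M[R]_((2 * N).+1) :=
  perm_mx (swap_perm N).

(* Z_2 is the additive group 'Z_2, with unit 0 and generator g = 1. *)
Definition rho_mx (R : realType) N (h : 'Z_2) : 'M[R]_((2 * N).+1) :=
  if h == 0 then 1%:M else involution_mx R N.

Lemma rho_mx_repr (R : realType) N : mx_repr [set: 'Z_2] (@rho_mx R N).
Proof.
split=> [|x y _ _]; first by rewrite /rho_mx eqxx.
have TT : involution_mx R N *m involution_mx R N = 1%:M.
  rewrite -perm_mxM -[RHS]perm_mx1; congr perm_mx.
  by apply/permP => u; rewrite permM !permE swap_copiesK.
by case: x y => [[|[|//]] ?] [[|[|//]] ?]; rewrite /rho_mx /= ?mul1mx ?mulmx1 ?TT.
Qed.

Definition rho (R : realType) N :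
    mx_representation R [set: 'Z_2] (2 * N).+1 :=
  MxRepresentation (@rho_mx_repr R N).

(* Limit for the entrywise sup norm on matrices. *)
Definition expmx (R : realType) n (A : 'M[R]_n.+1) : 'M[R]_n.+1 :=
  lim (series (fun k : nat => k`!%:R^-1 *: A ^+ k) @ \oo)%classic.

Definition heat_character (R : realType) N (t : R)
    (G : simple_graph (2 * N).+1) (h : 'Z_2) : R :=
  \tr (expmx (- t *: laplacian_mx R G) *m rho R N h).

(* The square roots of the eigenvalues of A^T A, each repeated according to
   its multiplicity as a root of the characteristic polynomial. *)
Definition singular_values (R : realType) n (A : 'M[R]_n) : seq R :=
  let p := char_poly (A^T *m A) in
  flatten [seq nseq (mup x p) (Num.sqrt x) | x <- polyrcf.rootsR p].

Definition trace_norm (R : realType) n (A : 'M[R]_n) : R :=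
  \sum_(s <- singular_values A) s.

(* Main.v *)
Require Import Defs.
From mathcomp Require Import all_boot all_order all_algebra all_fingroup.
From mathcomp Require Import all_classical all_reals all_analysis.
From mathcomp Require Import ring.
From mathcomp Require Import complex.
From mathcomp Require polyrcf.
Import Order.TTheory GRing.Theory Num.Theory.
Import numFieldNormedType.Exports.
Local Open Scope ring_scope.

(** The bound is Duhamel's formula combined with the duality between the trace
    norm and the operator norm.  For symmetric A1, A2 and any Q, put
    [phi s = tr (e^(-s A1) e^(-(t - s) A2) Q)].  Then [phi t] and [phi 0] are
    the two traces to be compared, and
    [phi' s = - tr (e^(-s A1) (A1 - A2) e^(-(t - s) A2) Q)].  By the mean value
    theorem the difference is [t] times a value of [phi'], and by cyclicity the
    latter is, up to sign, the trace of [A1 - A2] against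
    [e^(-(t - s) A2) Q e^(-s A1)].  When A1 and A2 are positive semidefinite,
    both exponentials are contractions of the Euclidean norm; so is
    [Q = rho h], a permutation matrix.  The trace of a symmetric B against a
    contraction is at most the trace norm of B ([trace_norm_duality]).  This is
    [heat_trace_lipschitz], which applies because Laplacians are positive
    semidefinite ([laplacian_psd]).

    All matrix analysis is made scalar by orthogonal diagonalization
    ([symmetric_orthogonal_diagonalization]): the exponential of
    [U^T diag(d) U] is [U^T diag(e^d) U], hence [phi] is a finite sum of scalar
    exponentials of affine functions of [s], and the trace norm of
    [U^T diag(b) U] is the sum of the [|b_i|].

    Over the reals the diagonalization is proved by induction on the size: a
    real unit eigenvector comes from the complex spectral theorem, and a
    Householder reflection turns it into the first basis vector. *)

Set Implicit Arguments.
Unset Strict Implicit.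
Unset Printing Implicit Defensive.

(** * Euclidean norm of row vectors *)

Definition sqnorm (R : realFieldType) n (v : 'rV[R]_n) : R := (v *m v^T) 0 0.

Lemma sqnormE (R : realFieldType) n (v : 'rV[R]_n) :
  sqnorm v = \sum_i v 0 i ^+ 2.
Proof. by rewrite /sqnorm mxE; apply: eq_bigr => i _; rewrite mxE expr2. Qed.

Lemma sqnorm_ge0 (R : realFieldType) n (v : 'rV[R]_n) : 0 <= sqnorm v.
Proof. by rewrite sqnormE sumr_ge0 // => i _; rewrite sqr_ge0. Qed.

Lemma sqnorm_eq0 (R : realFieldType) n (v : 'rV[R]_n) :
  (sqnorm v == 0) = (v == 0).
Proof.
apply/eqP/eqP => [|->]; last by rewrite /sqnorm mul0mx mxE.
rewrite sqnormE => s0; apply/rowP => i; rewrite mxE.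
apply/eqP; rewrite -sqrf_eq0; apply/eqP/(psumr_eq0P _ s0) => // k _.
exact: sqr_ge0.
Qed.

(** * Orthogonal diagonalization of real symmetric matrices *)

(** The complexification of A is Hermitian, so its eigenvalues are real; a real
    root of the real characteristic polynomial has a real eigenvector. *)
Lemma symmetric_eigenvector (R : rcfType) n (A : 'M[R]_n.+1) :
  A^T = A ->
  exists (a : R) (v : 'rV[R]_n.+1), v *m v^T = 1%:M /\ v *m A = a *: v.
Proof.
move=> Asym; pose C : numClosedFieldType := complex R.
pose toC : {rmorphism R -> C} := real_complex R.
pose B : 'M[C]_n.+1 := map_mx toC A.
have Bherm : B \is hermsymmx.
  apply/is_hermitianmxP; rewrite expr0 scale1r; apply/matrixP => i j.
  rewrite !mxE -[in LHS]Asym mxE; apply/esym/CrealP.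
  by apply/complex_realP; exists (A j i).
(* Diagonalizing B over the complex numbers gives real eigenvalues; the first
   one is then a root of the real characteristic polynomial of A. *)
pose P := spectralmx B; pose d := spectral_diag B.
have PU : P \in unitmx := spectral_unit B.
have PB : P *m B = diag_mx d *m P.
  have /orthomx_spectralP eqB := hermitian_normalmx Bherm.
  by rewrite {1}eqB !mulmxA mulmxV // mul1mx.
have /mxOverP/(_ 0 0)/complex_realP[a d0a] :=
  hermitian_spectral_diag_real Bherm.
have : eigenvalue B (toC a).
  apply/eigenvalueP; exists (row 0 P); last first.
    apply/eqP => /(congr1 (mulmx^~ (invmx P))).
    rewrite -row_mul mulmxV // mul0mx row1 => /rowP/(_ 0)/eqP.
    by rewrite !mxE eqxx oner_eq0.
  by rewrite -row_mul PB row_mul row_diag_mx -scalemxAl -rowE d0a.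
rewrite eigenvalue_root_char /B -map_char_poly fmorph_root.
rewrite -eigenvalue_root_char => /eigenvalueP[v vA v0].
pose c := Num.sqrt (sqnorm v).
have c0 : c != 0.
  by rewrite sqrtr_eq0 -ltNge lt_neqAle sqnorm_ge0 andbT eq_sym sqnorm_eq0.
exists a, (c^-1 *: v); split; last first.
  by rewrite -scalemxAl vA !scalerA mulrC.
rewrite linearZ /= -scalemxAl -scalemxAr scalerA [v *m _]mx11_scalar.
rewrite -[X in X%:M]/(sqnorm v) -(sqr_sqrtr (sqnorm_ge0 v)) -/c.
rewrite scale_scalar_mx expr2 mulrA.
by rewrite -(mulrA c^-1) mulVf // mulr1 mulVf.
Qed.

(** Householder: for [v != e], where [e] is the first basis vector, the
    reflection in the hyperplane orthogonal to [v - e] exchanges [e] and [v]. *)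
Lemma orthogonal_first_row (R : realFieldType) n (v : 'rV[R]_n.+1) :
  v *m v^T = 1%:M ->
  exists2 H : 'M[R]_n.+1, H *m H^T = 1%:M & row 0 H = v.
Proof.
move=> vv1; pose e : 'rV[R]_n.+1 := delta_mx 0 0; pose w := v - e.
have ee : e *m e^T = 1%:M.
  by rewrite trmx_delta mul_delta_mx; apply/matrixP => i j; rewrite !ord1 !mxE.
have ev : e *m v^T = (v 0 0)%:M.
  by apply/matrixP => i j; rewrite !ord1 -rowE !mxE mulr1n.
have ve : v *m e^T = (v 0 0)%:M.
  by rewrite -[LHS]trmxK trmx_mul trmxK ev tr_scalar_mx.
pose c := 1 - v 0 0.
have wwE : w *m w^T = (2 * c)%:M.
  rewrite linearB /= mulmxBl !mulmxBr vv1 ev ve ee.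
  by apply/matrixP => i j; rewrite !ord1 !mxE eqxx !mulr1n /c; ring.
have [c0|c0] := eqVneq c 0.
  (* Here [v = e], and there is no reflection. *)
  exists 1%:M; first by rewrite trmx1 mulmx1.
  rewrite row1; apply/eqP; rewrite eq_sym -subr_eq0 -/e -/w -sqnorm_eq0.
  by rewrite /sqnorm wwE c0 mulr0 !mxE mul0rn.
(* The reflection [1 - 2 w^T w / (w w^T)], since [w w^T = 2 c]. *)
pose H := 1%:M - c^-1 *: (w^T *m w).
have HT : H^T = H by rewrite linearB /= linearZ /= trmx_mul trmxK trmx1.
exists H.
  have XX : w^T *m w *m (w^T *m w) = (2 * c) *: (w^T *m w).
    by rewrite mulmxA -(mulmxA w^T) wwE mul_mx_scalar scalemxAl.
  rewrite HT mulmxBl mul1mx mulmxBr mulmx1 -scalemxAl -scalemxAr XX !scalerA.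
  by apply/matrixP => i j; rewrite !mxE; field.
have ew : e *m w^T = (- c)%:M.
  by rewrite linearB /= mulmxBr ev ee -raddfB opprB.
rewrite rowE -/e mulmxBr mulmx1 -scalemxAr mulmxA ew mul_scalar_mx scalerA.
by rewrite mulrN mulVf // scaleN1r opprK /w addrC subrK.
Qed.

(** For orthogonal [U], the symmetric matrix with eigenvalues [d] in the
    orthonormal basis formed by the rows of [U]; applying a scalar function to
    [d] is then the functional calculus. *)
Definition spectral_mx (R : pzSemiRingType) n (U : 'M[R]_n)
    (d : 'rV[R]_n) : 'M[R]_n :=
  U^T *m diag_mx d *m U.

(** Splitting off one unit eigenvector leaves a symmetric matrix of smaller size
    on its orthogonal complement. *)
Theorem symmetric_orthogonal_diagonalization (R : rcfType) n (A : 'M[R]_n) :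
  A^T = A ->
  exists (U : 'M[R]_n) (d : 'rV[R]_n),
    U *m U^T = 1%:M /\ A = spectral_mx U d.
Proof.
rewrite /spectral_mx; elim: n A => [|n IHn] A Asym.
  by exists 1%:M, 0; split; apply/matrixP => -[].
have [a [v [vv1 vA]]] := symmetric_eigenvector Asym.
have [H HH1 H0] := orthogonal_first_row vv1.
have HTH : H^T *m H = 1%:M by apply: mulmx1C.
pose A' : 'M[R]_(1 + n) := H *m A *m H^T.
have A'sym : A'^T = A' by rewrite !trmx_mul trmxK Asym mulmxA.
(* In a basis starting with the eigenvector, A is block diagonal. *)
have row0 : row 0 A' = a *: delta_mx 0 0.
  rewrite row_mul row_mul H0 vA -scalemxAl; congr (_ *: _).
  by rewrite -H0 -row_mul HH1 row1.
have ur0 : ursubmx A' = 0.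
  apply/matrixP => i j; rewrite ord1 mxE mxE [RHS]mxE.
  have /rowP/(_ (rshift 1 j)) := row0.
  rewrite mxE [RHS]mxE [X in _ = _ * X]mxE /= mulr0.
  move=> A0j; rewrite -[RHS]A0j; congr (A' _ _); exact: val_inj.
have dl0 : dlsubmx A' = 0 by rewrite -[LHS]trmxK trmx_dlsub A'sym ur0 trmx0.
have drsym : (drsubmx A')^T = drsubmx A' by rewrite trmx_drsub A'sym.
have [U [d [UU1 eqd]]] := IHn _ drsym.
pose W : 'M[R]_(1 + n) := block_mx 1%:M 0 0 U.
pose e : 'rV[R]_(1 + n) := row_mx (const_mx (ulsubmx A' 0 0)) d.
have WW1 : W *m W^T = 1%:M.
  rewrite tr_block_mx mulmx_block !trmx0 trmx1 !mulmx0 !mul0mx !addr0 !add0r.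
  by rewrite mul1mx UU1 -scalar_mx_block.
have A'E : A' = W^T *m diag_mx e *m W.
  rewrite -[LHS]submxK ur0 dl0 eqd diag_mx_row tr_block_mx !mulmx_block.
  rewrite !trmx0 !trmx1 !mulmx0 !mul0mx !addr0 !add0r !mul1mx !mulmx1 !mul0mx.
  by rewrite diag_const_mx -mx11_scalar.
exists (W *m H : 'M[R]_n.+1), (e : 'rV[R]_n.+1); split.
  by rewrite trmx_mul mulmxA -(mulmxA W) HH1 mulmx1 WW1.
have -> : A = H^T *m A' *m H.
  by rewrite /A' !mulmxA HTH mul1mx -mulmxA HTH mulmx1.
by rewrite A'E trmx_mul !mulmxA.
Qed.

(** * Functional calculus and the matrix exponential *)

Lemma spectral_mx_sum (R : comPzRingType) n (U : 'M[R]_n) (d : 'rV[R]_n) :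
  spectral_mx U d = \sum_i d 0 i *: (U^T *m delta_mx i i *m U).
Proof.
rewrite /spectral_mx diag_mx_sum_delta mulmx_sumr mulmx_suml.
by apply: eq_bigr => i _; rewrite -scalemxAr -scalemxAl.
Qed.

Lemma spectral_mxZ (R : comPzRingType) n (U : 'M[R]_n) (d : 'rV[R]_n) c :
  c *: spectral_mx U d = spectral_mx U (c *: d).
Proof. by rewrite /spectral_mx linearZ /= -scalemxAr -scalemxAl. Qed.

Lemma spectral_mxM (R : comPzRingType) n (U : 'M[R]_n) (d e : 'rV[R]_n) :
  U *m U^T = 1%:M ->
  spectral_mx U d *m spectral_mx U e = spectral_mx U (\row_j (d 0 j * e 0 j)).
Proof.
move=> UU; rewrite /spectral_mx -!mulmxA (mulmxA U) UU mul1mx.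
by rewrite (mulmxA (diag_mx d)) mulmx_diag.
Qed.

Lemma spectral_mxX (R : comNzRingType) n (U : 'M[R]_n.+1) (d : 'rV[R]_n.+1) k :
  U *m U^T = 1%:M ->
  spectral_mx U d ^+ k = spectral_mx U (map_mx (fun x => x ^+ k) d).
Proof.
move=> UU; elim: k => [|k IHk].
  rewrite expr0 (_ : map_mx _ _ = const_mx 1); last first.
    by apply/rowP => j; rewrite !mxE.
  by rewrite /spectral_mx diag_const_mx mulmx1 (mulmx1C UU).
rewrite exprS IHk -[LHS]/(_ *m _) spectral_mxM //; congr spectral_mx.
by apply/rowP => j; rewrite !mxE exprS.
Qed.

(** The partial sums of the exponential series are combinations of fixed
    spectral projections whose coefficients are scalar partial sums, so the limit
    can be taken coefficient by coefficient. *)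
Lemma expmx_spectral (R : realType) n (U : 'M[R]_n.+1) (d : 'rV[R]_n.+1) :
  U *m U^T = 1%:M -> expmx (spectral_mx U d) = spectral_mx U (map_mx expR d).
Proof.
move=> UU; apply: cvg_lim => //.
have -> : series (fun k => k`!%:R^-1 *: spectral_mx U d ^+ k) =
    fun m => \sum_i series (exp_coeff (d 0 i)) m *: (U^T *m delta_mx i i *m U).
  apply/funext => m; rewrite /series /=.
  under [RHS]eq_bigr do rewrite scaler_suml.
  rewrite exchange_big /=; apply: eq_bigr => k _.
  rewrite spectral_mxX // spectral_mx_sum scaler_sumr; apply: eq_bigr => i _.
  by rewrite mxE scalerA mulrC.
rewrite spectral_mx_sum; apply: cvg_big => [|i _].
  exact: add_continuous.
rewrite mxE; apply: cvgZr_tmp.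
exact: is_cvg_series_exp_coeff.
Qed.

(** * The trace norm of a symmetric matrix *)

Lemma char_poly_spectral (R : comNzRingType) n (U : 'M[R]_n) (d : 'rV[R]_n) :
  U *m U^T = 1%:M ->
  char_poly (spectral_mx U d) = \prod_(i < n) ('X - (d 0 i)%:P).
Proof.
move=> UU; pose V := map_mx polyC U.
have VV : V *m V^T = 1%:M by rewrite map_trmx -map_mxM UU map_mx1.
have -> : char_poly (spectral_mx U d) = char_poly (diag_mx d).
  rewrite /char_poly (_ : char_poly_mx _ = V^T *m char_poly_mx (diag_mx d) *m V).
    rewrite !det_mulmx mulrAC -det_mulmx (mulmx1C VV) det1.
    by rewrite mul1r.
  rewrite /char_poly_mx mulmxBr mulmxBl mul_mx_scalar -scalemxAl (mulmx1C VV).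
  by rewrite scalemx1 /spectral_mx !map_mxM map_trmx.
rewrite char_poly_trig ?diag_mx_is_trig //.
by apply: eq_bigr => i _; rewrite mxE eqxx.
Qed.

(** [B^T B] has the eigenvalues [b_i ^ 2], whose square roots are the [|b_i|];
    what remains is that summing over distinct roots with multiplicity is summing
    over all [i]. *)
Lemma trace_norm_spectral (R : realType) n (U : 'M[R]_n) (b : 'rV[R]_n) :
  U *m U^T = 1%:M -> trace_norm (spectral_mx U b) = \sum_i `|b 0 i|.
Proof.
move=> UU; rewrite /trace_norm /singular_values.
have -> : (spectral_mx U b)^T = spectral_mx U b.
  by rewrite /spectral_mx !trmx_mul trmxK tr_diag_mx mulmxA.
rewrite spectral_mxM // char_poly_spectral //.
pose s : seq R := [seq b 0 i ^+ 2 | i <- enum 'I_n].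
rewrite (_ : \prod_i _ = \prod_(x <- s) ('X - x%:P)); last first.
  by rewrite big_map big_enum /=; apply: eq_bigr => i _; rewrite mxE expr2.
set p := \prod_(x <- s) _.
have p0 : p != 0 by rewrite monic_neq0 // monic_prod_XsubC.
have roots_s : perm_eq (polyrcf.rootsR p) (undup s).
  apply: uniq_perm; rewrite ?undup_uniq //.
    exact: sorted_uniq lt_trans ltxx _ (polyrcf.sorted_roots _ _ _).
  move=> x; have := polyrcf.roots_on_rootsR p0 x.
  by rewrite in_itv /= mem_undup root_prod_XsubC => <-.
rewrite big_flatten big_map (perm_big _ roots_s) /=.
transitivity (\sum_(x <- s) Num.sqrt x).
  rewrite -[RHS]big_undup_iterop_count; apply: eq_bigr => x _.
  rewrite mu_prod_XsubC big_nseq.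
  by rewrite Monoid.iteropE.
by rewrite big_map big_enum /=; apply: eq_bigr => i _; rewrite sqrtr_sqr.
Qed.

(** * Contractions *)

Definition contraction (R : realFieldType) n (Q : 'M[R]_n) : Prop :=
  forall v : 'rV[R]_n, sqnorm (v *m Q) <= sqnorm v.

Lemma contractionM (R : realFieldType) n (P Q : 'M[R]_n) :
  contraction P -> contraction Q -> contraction (P *m Q).
Proof. by move=> cP cQ v; rewrite mulmxA (le_trans (cQ _)). Qed.

Lemma orthogonal_contraction (R : realFieldType) n (Q : 'M[R]_n) :
  Q *m Q^T = 1%:M -> contraction Q.
Proof. by move=> QQ v; rewrite /sqnorm trmx_mul mulmxA -(mulmxA v) QQ mulmx1. Qed.

Lemma diag_contraction (R : realFieldType) n (d : 'rV[R]_n) :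
  (forall i, 0 <= d 0 i <= 1) -> contraction (diag_mx d).
Proof.
move=> d01 v; rewrite !sqnormE; apply: ler_sum => i _.
have /andP[d0 d1] := d01 i.
by rewrite mul_mx_diag mxE exprMn ler_piMr ?sqr_ge0 // exprn_ile1.
Qed.

Lemma spectral_contraction (R : realFieldType) n (U : 'M[R]_n) (d : 'rV[R]_n) :
  U *m U^T = 1%:M -> (forall i, 0 <= d 0 i <= 1) ->
  contraction (spectral_mx U d).
Proof.
move=> UU d01; apply: contractionM; last exact: orthogonal_contraction.
apply: contractionM; last exact: diag_contraction.
by apply: orthogonal_contraction; rewrite trmxK (mulmx1C UU).
Qed.

Lemma contraction_entry_le1 (R : realFieldType) n (Q : 'M[R]_n) i j :
  contraction Q -> `|Q i j| <= 1.
Proof.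
move=> cQ; rewrite -(@ler_pXn2r _ 2) ?nnegrE ?normr_ge0 ?ler01 //.
rewrite real_normK ?num_real // expr1n.
(* The i-th row of Q is the image of a unit vector. *)
have := cQ (delta_mx 0 i); rewrite -rowE !sqnormE.
rewrite [leRHS](bigD1 i) //= [X in _ <= _ + X]big1; last first.
  by move=> k /negPf ki; rewrite mxE ki andbF expr0n.
rewrite mxE !eqxx expr1n addr0; apply: le_trans.
rewrite (bigD1 j) //= mxE lerDl sumr_ge0 // => k _; exact: sqr_ge0.
Qed.

(** In an orthonormal eigenbasis of B the trace is [sum b_i q_ii], where the
    [q_ii] are diagonal entries of a contraction. *)
Lemma trace_norm_duality (R : realType) n (B Q : 'M[R]_n) :
  B^T = B -> contraction Q -> `|\tr (B *m Q)| <= trace_norm B.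
Proof.
move=> Bsym cQ; have [W [b [WW BE]]] := symmetric_orthogonal_diagonalization Bsym.
rewrite BE trace_norm_spectral //.
rewrite /spectral_mx -!mulmxA mxtrace_mulC -!mulmxA mul_diag_mx.
apply: le_trans (ler_norm_sum _ _ _) _; apply: ler_sum => i _.
rewrite mxE normrM ler_piMr //; apply: contraction_entry_le1.
apply: contractionM; first exact: orthogonal_contraction.
apply: contractionM => //; apply: orthogonal_contraction.
by rewrite trmxK (mulmx1C WW).
Qed.

(** * Duhamel estimate for heat traces *)

Definition psd (R : realFieldType) n (A : 'M[R]_n) : Prop :=
  forall v : 'rV[R]_n, 0 <= (v *m A *m v^T) 0 0.

Lemma psd_spectral_ge0 (R : realFieldType) n (U : 'M[R]_n) (d : 'rV[R]_n) i :
  U *m U^T = 1%:M -> psd (spectral_mx U d) -> 0 <= d 0 i.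
Proof.
move=> UU /(_ (row i U)).
rewrite -row_mul /spectral_mx !mulmxA UU mul1mx row_mul row_diag_mx -scalemxAl.
rewrite -rowE -scalemxAl mxE.
suff -> : (row i U *m (row i U)^T) 0 0 = 1 by rewrite mulr1.
by rewrite tr_row colE mulmxA -row_mul UU -colE !mxE eqxx.
Qed.

(** Writing both factors in their own eigenbases exposes the trace as a bilinear
    form in the two spectra, with coefficients that depend only on the bases
    and Q. *)
Lemma trace_spectral2 (R : comPzRingType) n (U V Q : 'M[R]_n) (x y : 'rV[R]_n) :
  \tr (spectral_mx U x *m spectral_mx V y *m Q) =
  \sum_i \sum_j x 0 i * y 0 j * ((U *m V^T) i j * (V *m Q *m U^T) j i).
Proof.
rewrite /spectral_mx -!mulmxA mxtrace_mulC -!mulmxA mul_diag_mx.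
apply: eq_bigr => i _; rewrite mxE !mulmxA -(mulmxA _ V) -(mulmxA _ (V *m Q)).
rewrite mul_mx_diag mxE mulr_sumr; apply: eq_bigr => j _.
by rewrite mxE; ring.
Qed.

Lemma is_derive_expR_affine (R : realType) (k m c x : R) :
  is_derive x 1 (fun s => expR (s * k - m) * c) (expR (x * k - m) * k * c).
Proof.
have kD : is_derive x 1 (fun s => s * k - m) k.
  by apply: is_derive_eq; rewrite subr0 scaler0 add0r [LHS]mulr1.
have eD := @is_derive1_comp _ expR (fun s => s * k - m) _ _ _
  (is_derive_expR (x * k - m)) kD.
rewrite (_ : (fun s => _) = c \*: (expR \o (fun s => s * k - m))).
  by apply: is_derive_eq; rewrite [LHS]mulrC.
by apply/funext => s /=; rewrite [RHS]mulrC.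
Qed.

(** Duhamel's formula in mean value form: [phi] below interpolates between the two
    heat traces, and its derivative pairs [A1 - A2] with a contraction. *)
Theorem heat_trace_lipschitz (R : realType) n (A1 A2 Q : 'M[R]_n.+1) (t : R) :
  A1^T = A1 -> A2^T = A2 -> psd A1 -> psd A2 -> contraction Q -> 0 <= t ->
  `|\tr (expmx (- t *: A1) *m Q) - \tr (expmx (- t *: A2) *m Q)|
    <= t * trace_norm (A1 - A2).
Proof.
move=> A1sym A2sym psd1 psd2 cQ t0.
have Bsym : (A1 - A2)^T = A1 - A2 by rewrite linearB /= A1sym A2sym.
have [U [a [UU A1E]]] := symmetric_orthogonal_diagonalization A1sym.
have [V [b [VV A2E]]] := symmetric_orthogonal_diagonalization A2sym.
(* The spectra of [e^(-s A1)] and [e^(-(t - s) A2)]. *)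
pose x s : 'rV[R]_n.+1 := map_mx expR (- s *: a).
pose y s : 'rV[R]_n.+1 := map_mx expR (- (t - s) *: b).
have xE s i : x s 0 i = expR (- s * a 0 i) by rewrite !mxE.
have yE s j : y s 0 j = expR (- (t - s) * b 0 j) by rewrite !mxE.
pose phi s := \tr (spectral_mx U (x s) *m spectral_mx V (y s) *m Q).
pose dphi s :=
  - \tr (spectral_mx U (x s) *m (A1 - A2) *m spectral_mx V (y s) *m Q).
have phi_derive (s : R) : is_derive s 1 phi (dphi s).
  pose c i j := (U *m V^T) i j * (V *m Q *m U^T) j i.
  have phiE : phi = \sum_i \sum_j
      (fun s => expR (s * (b 0 j - a 0 i) - t * b 0 j) * c i j).
    apply/funext => r; rewrite /phi trace_spectral2 fct_sumE.
    apply: eq_bigr => i _; rewrite fct_sumE; apply: eq_bigr => j _.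
    by rewrite xE yE -expRD -/(c i j); congr (expR _ * _); ring.
  have xaE i : (\row_k (x s 0 k * a 0 k)) 0 i = expR (- s * a 0 i) * a 0 i.
    by rewrite mxE xE.
  have ybE j :
      (\row_k (b 0 k * y s 0 k)) 0 j = b 0 j * expR (- (t - s) * b 0 j).
    by rewrite mxE yE.
  have dphiE : dphi s = \sum_i \sum_j
      (expR (s * (b 0 j - a 0 i) - t * b 0 j) * (b 0 j - a 0 i) * c i j).
    rewrite /dphi mulmxBr !mulmxBl {1}A1E {1}A2E spectral_mxM //.
    rewrite -(mulmxA _ (spectral_mx V b)) spectral_mxM // linearB /=.
    rewrite opprB !trace_spectral2 -sumrB.
    apply: eq_bigr => i _; rewrite -sumrB; apply: eq_bigr => j _.
    rewrite xaE ybE xE yE.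
    have -> : s * (b 0 j - a 0 i) - t * b 0 j =
      - s * a 0 i + - (t - s) * b 0 j by ring.
    by rewrite expRD /c; ring.
  rewrite phiE dphiE; apply: is_derive_sum => i; apply: is_derive_sum => j.
  exact: is_derive_expR_affine.
have phi_cont : ({within `[0, t], continuous phi})%classic.
  by apply: derivable_within_continuous => s _; case: (phi_derive s).
have [s s0t phi_mvt] := MVT_segment t0 (fun s _ => phi_derive s) phi_cont.
have := s0t; rewrite in_itv /= => /andP[s0 st].
have phit : phi t = \tr (expmx (- t *: A1) *m Q).
  rewrite /phi A1E spectral_mxZ expmx_spectral // /y subrr oppr0 scale0r.
  rewrite (_ : map_mx expR 0 = const_mx 1); last first.
    by apply/rowP => j; rewrite !mxE expR0.
  by rewrite {2}/spectral_mx diag_const_mx mulmx1 (mulmx1C VV) mulmx1.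
have phi0 : phi 0 = \tr (expmx (- t *: A2) *m Q).
  rewrite /phi A2E spectral_mxZ expmx_spectral // /y subr0 /x oppr0 scale0r.
  rewrite (_ : map_mx expR 0 = const_mx 1); last first.
    by apply/rowP => j; rewrite !mxE expR0.
  by rewrite {1}/spectral_mx diag_const_mx mulmx1 (mulmx1C UU) mul1mx.
rewrite -phit -phi0 phi_mvt subr0 mulrC normrM ger0_norm //.
apply: ler_wpM2l => //; rewrite /dphi normrN.
(* The eigenvalues of A1 and A2 are nonnegative and [s], [t - s] are too, so the
   exponentials have spectra in the unit interval. *)
have expR01 r (d : 'rV[R]_n.+1) i : 0 <= r -> 0 <= d 0 i ->
    0 <= map_mx expR (- r *: d) 0 i <= 1.
  by move=> r0 d0; rewrite !mxE expR_ge0 -expR0 ler_expR mulNr oppr_le0 mulr_ge0.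
have : contraction (spectral_mx U (x s)).
  apply: spectral_contraction => // i; apply: expR01 => //.
  by apply: psd_spectral_ge0 UU _; rewrite -A1E.
have : contraction (spectral_mx V (y s)).
  apply: spectral_contraction => // i; apply: expR01; rewrite ?subr_ge0 //.
  by apply: psd_spectral_ge0 VV _; rewrite -A2E.
move: (spectral_mx U _) (spectral_mx V _) => X Y cY cX.
rewrite -!mulmxA mxtrace_mulC -!mulmxA; apply: trace_norm_duality => //.
by do 2!apply: contractionM => //.
Qed.

(** * Graph Laplacians and the involution *)

Lemma laplacian_sym (R : realType) n (G : simple_graph n) :
  (laplacian_mx R G)^T = laplacian_mx R G.
Proof.
rewrite /laplacian_mx linearB /= tr_diag_mx; congr (_ - _).
by apply/matrixP => i j; rewrite !mxE adj_sym.
Qed.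

Lemma laplacian_form (R : realType) n (G : simple_graph n) (v : 'rV[R]_n) :
  (v *m laplacian_mx R G *m v^T) 0 0 =
  2^-1 * \sum_i \sum_j (adj G i j)%:R * (v 0 i - v 0 j) ^+ 2.
Proof.
pose q i j : R := (adj G i j)%:R * (v 0 i ^+ 2 - v 0 i * v 0 j).
have formE : (v *m laplacian_mx R G *m v^T) 0 0 = \sum_i \sum_j q i j.
  rewrite mxE; transitivity (\sum_i ((degree G i)%:R * v 0 i ^+ 2 -
                              \sum_j (adj G i j)%:R * (v 0 i * v 0 j))).
    apply: eq_bigr => i _; rewrite mulmxBr mul_mx_diag !mxE mulrBl.
    rewrite mulr_suml; congr (_ - _); first by ring.
    by apply: eq_bigr => j _; rewrite mxE adj_sym; ring.
  apply: eq_bigr => i _; rewrite /degree -sum1_card natr_sum big_mkcond /=.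
  rewrite mulr_suml -sumrB.
  apply: eq_bigr => j _; rewrite inE /q; case: (adj G i j); rewrite /=; ring.
rewrite formE; set S := \sum_i _; apply: (@mulfI _ 2); first by rewrite pnatr_eq0.
(* Adding the sum to its copy with i and j exchanged completes the square. *)
rewrite mulrA divff ?pnatr_eq0 // mul1r mulr_natl mulr2n {2}/S exchange_big.
rewrite -big_split; apply: eq_bigr => i _.
rewrite -big_split; apply: eq_bigr => j _.
by rewrite /q adj_sym /=; ring.
Qed.

Lemma laplacian_psd (R : realType) n (G : simple_graph n) :
  psd (laplacian_mx R G).
Proof.
move=> v; rewrite laplacian_form mulr_ge0 ?invr_ge0 ?ler0n //.
by do 2!(apply: sumr_ge0 => ? _); rewrite mulr_ge0 ?ler0n ?sqr_ge0.
Qed.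

Lemma rho_mx_contraction (R : realType) N h : contraction (rho_mx R N h).
Proof.
rewrite /rho_mx; case: ifP => _; apply: orthogonal_contraction.
  by rewrite trmx1 mulmx1.
by rewrite tr_perm_mx -perm_mxM mulgV perm_mx1.
Qed.

Theorem proposition5p3 (R : realType) (N : nat) (G1 G2 : self_loop_graph N)
    (hG1 : loops G1 != finset.set0) (hG2 : loops G2 != finset.set0)
    (h : 'Z_2) (t : R) (ht : 0 < t) :
  `| heat_character t (acikmese_lift G1) h
     - heat_character t (acikmese_lift G2) h |
  <= t * trace_norm (laplacian_mx R (acikmese_lift G1)
                     - laplacian_mx R (acikmese_lift G2)).
Proof.
apply: heat_trace_lipschitz (ltW ht);
  [exact: laplacian_sym | exact: laplacian_sym
  |exact: laplacian_psd | exact: laplacian_psd |].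
exact: rho_mx_contraction.
Qed.
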